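(* For every integer $n\geq 2$, \[ m_3(K_{1,2}, P_4, nK_2)\leq \left\lfloor \frac{2n}{3} \right\rfloor+1. \]
   Context: $K_{3\times t}$ denotes the complete 3-partite graph with three partite classes of size $t$. $m_3(G_1,G_2,G_3)$ is the smallest positive integer $t$ such that every 3-coloring of the edges of $K_{3\times t}$ contains, for some $i\in\{1,2,3\}$, a copy of $G_i$ all of whose edges have color $i$. $K_{1,2}$ is the path on 3 vertices, $P_4$ the path on 4 vertices, and $nK_2$ the matching of $n$ disjoint edges. *)

(* Defs.v *)
From HB Require Import structures.
From mathcomp Require Import all_boot.

Set Implicit Arguments.
Unset Strict Implicit.
Unset Printing Implicit Defensive.

Record sgraph := SGraph {
  vertex :> finType;
  adj : rel vertex;
  adj_sym : symmetric adj;
  adj_irrefl : irreflexive adj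
}.

(* H is isomorphic to a (not necessarily induced) subgraph of G. *)
Definition contains_copy (G H : sgraph) : Prop :=
  exists f : H -> G,
    injective f /\ forall u v : H, adj u v -> adj (f u) (f v).

(* K_{j x t}: vertex (p, x) is the x-th vertex of the p-th partite class. *)
Definition multipartite_adj (j t : nat) : rel ('I_j * 'I_t) :=
  fun u v => u.1 != v.1.

Fact multipartite_sym j t : symmetric (@multipartite_adj j t).
Proof. by move=> u v; rewrite /multipartite_adj eq_sym. Qed.

Fact multipartite_irrefl j t : irreflexive (@multipartite_adj j t).
Proof. by move=> u; rewrite /multipartite_adj eqxx. Qed.

Definition complete_multipartite (j t : nat) : sgraph :=
  SGraph (@multipartite_sym j t) (@multipartite_irrefl j t).

Definition bipartite_adj (a b : nat) : rel ('I_a + 'I_b) :=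
  fun u v => is_inl u != is_inl v.

Fact bipartite_sym a b : symmetric (@bipartite_adj a b).
Proof. by move=> u v; rewrite /bipartite_adj eq_sym. Qed.

Fact bipartite_irrefl a b : irreflexive (@bipartite_adj a b).
Proof. by move=> u; rewrite /bipartite_adj eqxx. Qed.

Definition complete_bipartite (a b : nat) : sgraph :=
  SGraph (@bipartite_sym a b) (@bipartite_irrefl a b).

Definition path_adj (k : nat) : rel 'I_k :=
  fun u v => (u.+1 == v :> nat) || (v.+1 == u :> nat).

Fact path_sym k : symmetric (@path_adj k).
Proof. by move=> u v; rewrite /path_adj orbC. Qed.

Fact path_irrefl k : irreflexive (@path_adj k).
Proof. by move=> u; rewrite /path_adj orbb gtn_eqF. Qed.

(* P_k, with k the number of vertices. *)
Definition path_graph (k : nat) : sgraph :=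
  SGraph (@path_sym k) (@path_irrefl k).

Definition matching_adj (n : nat) : rel ('I_n * bool) :=
  fun u v => (u.1 == v.1) && (u.2 != v.2).

Fact matching_sym n : symmetric (@matching_adj n).
Proof.
by move=> u v; rewrite /matching_adj eq_sym [u.2 == _]eq_sym.
Qed.

Fact matching_irrefl n : irreflexive (@matching_adj n).
Proof. by move=> u; rewrite /matching_adj !eqxx. Qed.

(* n K_2: the i-th edge joins (i, false) and (i, true). *)
Definition matching_graph (n : nat) : sgraph :=
  SGraph (@matching_sym n) (@matching_irrefl n).

(* An edge {u, v} has colour c [set u; v]; the values of c on sets that are
   not edges play no role. *)
Definition colour_adj (K : sgraph) (k : nat) (c : {set K} -> 'I_k) (i : 'I_k) :
  rel K := fun u v => adj u v && (c [set u; v] == i).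

Fact colour_sym K k (c : {set vertex K} -> 'I_k) i :
  symmetric (colour_adj c i).
Proof. by move=> u v; rewrite /colour_adj adj_sym setUC. Qed.

Fact colour_irrefl K k (c : {set vertex K} -> 'I_k) i :
  irreflexive (colour_adj c i).
Proof. by move=> u; rewrite /colour_adj adj_irrefl. Qed.

Definition colour_class (K : sgraph) (k : nat) (c : {set K} -> 'I_k)
  (i : 'I_k) : sgraph := SGraph (colour_sym c i) (colour_irrefl c i).

(* The colours are indexed from 0. *)
Definition family3 (G1 G2 G3 : sgraph) (i : 'I_3) : sgraph :=
  match val i with 0 => G1 | 1 => G2 | _ => G3 end.

Definition arrows (K G1 G2 G3 : sgraph) : Prop :=
  forall c : {set K} -> 'I_3,
    exists i : 'I_3, contains_copy (colour_class c i) (family3 G1 G2 G3 i).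

(* t = m_j(G1, G2, G3). *)
Definition is_multipartite_ramsey (j : nat) (G1 G2 G3 : sgraph) (t : nat) :
  Prop :=
  [/\ 0 < t,
      arrows (complete_multipartite j t) G1 G2 G3
    & forall s : nat,
        0 < s -> arrows (complete_multipartite j s) G1 G2 G3 -> t <= s].

(* Main.v *)
Require Import Defs.
From HB Require Import structures.
From mathcomp Require Import all_boot zify.
From Stdlib Require Import Classical.

Set Implicit Arguments.
Unset Strict Implicit.
Unset Printing Implicit Defensive.

(** Colours 0, 1, 2 are called red, blue and green. Suppose that red is a
    matching and that blue has no P_4, and let M be a maximum green matching,
    with |M| = m < n; then at least 3t - 2m >= 3 vertices are uncovered. No
    green edge joins two uncovered vertices, and no edge of M extends to a
    green augmenting path of length 3.
    If two vertices of a class A are uncovered, then at most one edge of M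
    avoids A, because two such edges would force too many red and blue edges
    to uncovered vertices. Hence m <= t - 1, and as an edge of M meets each
    class at most once, every class has an uncovered vertex. If no class has
    two uncovered vertices, every class has exactly one. In both cases there
    is an uncovered vertex in each class, and such a triangle, being red and
    blue, forces m <= 1. So at least four vertices are uncovered, and four of
    them span a red-blue copy of K_4 minus an edge, which is impossible. *)

(** * Matchings as lists of edges *)

Section Matchings.
Variable T : finType.
Implicit Types (M : seq (T * T)) (r : rel T).

Definition support M := flatten [seq [:: e.1; e.2] | e <- M].

(** Edges are ordered pairs in arbitrary orientation. One [uniq] on the list of all endpoints
    excludes both loops and shared vertices. *)
Definition matching r M := all (fun e => r e.1 e.2) M && uniq (support M).

Lemma support_cons e M : support (e :: M) = [:: e.1, e.2 & support M].
Proof. by []. Qed.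

Lemma size_support M : size (support M) = (size M).*2.
Proof. by elim: M => //= e M ->. Qed.

Lemma perm_support M1 M2 :
  perm_eq M1 M2 -> perm_eq (support M1) (support M2).
Proof. by move=> ?; apply/perm_flatten/perm_map. Qed.

Lemma perm_matching r M1 M2 :
  perm_eq M1 M2 -> matching r M1 = matching r M2.
Proof.
move=> eM; rewrite /matching (perm_all _ eM).
by rewrite (perm_uniq (perm_support eM)).
Qed.

Lemma mem_support x y M :
  (x, y) \in M -> x \in support M /\ y \in support M.
Proof.
move=> xyM; rewrite !(perm_mem (perm_support (perm_to_rem xyM))) support_cons.
by rewrite !inE !eqxx !orbT.
Qed.

Lemma nth_support x0 M i (b : bool) : i < size M ->
  nth x0 (support M) (i.*2 + b)
    = (if b then snd else fst) (nth (x0, x0) M i).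
Proof.
elim: M i => [|e M IH] [|i] //= ltiM; first by case: (b).
by rewrite -(IH i).
Qed.

Lemma ex_max_matching r : exists2 M, matching r M
  & forall M', matching r M' -> size M' <= size M.
Proof.
(* Tuples of a fixed length form a finite type, so [P] is boolean. Sizes are bounded because the
   endpoints are distinct elements of [T]. *)
pose P k := [exists M : k.-tuple (T * T), matching r M].
have PM M : matching r M -> P (size M).
  by move=> mM; apply/existsP; exists (in_tuple M).
have exP : exists k, P k by exists 0; apply: (PM [::]).
have ubP k : P k -> k <= #|T|.
  case/existsP=> M /andP[_ uM].
  have := uniq_leq_size uM (fun x _ => mem_enum T x).
  rewrite size_support size_tuple -cardT -addnn.
  by apply: leq_trans; apply: leq_addr.
case: (ex_maxnP exP ubP) => m /existsP[M mM] max_m.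
by exists M => // M' /PM /max_m; rewrite size_tuple.
Qed.

(** Moving the edges that satisfy [p] to the front keeps a matching, whose first four endpoints are
    then distinct. *)
Lemma matching_two_edges r (p : pred (T * T)) M :
    matching r M -> 1 < count p M ->
  exists x y x' y', [/\ (x, y) \in M, (x', y') \in M, p (x, y), p (x', y')
    & uniq [:: x; y; x'; y']].
Proof.
move=> mM; rewrite -size_filter => size_p.
have : matching r (filter p M ++ filter (predC p) M).
  by rewrite (perm_matching _ (permEl (perm_filterC p M))).
have sub e : e \in filter p M -> (e \in M) /\ p e.
  by rewrite mem_filter => /andP[].
case: (filter p M) size_p sub => [|[x y] [|[x' y'] N]] //= _ sub.
case/andP=> _; rewrite !support_cons => uN.
have [xyM pxy] := sub (x, y) (mem_head _ _).
have [xyM' pxy'] : (x', y') \in M /\ p (x', y').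
  by apply: sub; rewrite !inE eqxx orbT.
exists x, y, x', y'; split=> //.
by have := uN : uniq ([:: x; y; x'; y'] ++ _); rewrite cat_uniq => /andP[].
Qed.

Lemma card_uncovered (P : pred T) (S : seq T) : uniq S ->
  #|[pred v | P v & v \notin S]| + count P S = #|P|.
Proof.
move=> uS; rewrite -size_filter -(card_uniqP (filter_uniq P uS)).
rewrite -(cardID (mem S) P) addnC; congr (_ + _).
  by apply: eq_card => v; rewrite !inE mem_filter andbC.
by apply: eq_card => v; rewrite !inE andbC.
Qed.

End Matchings.

(** * A coloured tripartite graph with a maximum green matching *)

Section ColouredMultipartite.
Variables (T : finType) (cls : T -> 'I_3) (red blue green : rel T).

Hypothesis coloured :
  forall u v, cls u != cls v -> [\/ red u v, blue u v | green u v].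
Hypotheses (redC : symmetric red) (blueC : symmetric blue).
Hypothesis greenC : symmetric green.
Hypothesis green_cls : forall u v, green u v -> cls u != cls v.
Hypothesis red_inj : forall x y z, red x y -> red x z -> y = z.
Hypothesis blue_no_P4 : forall w x y z,
  blue w x -> blue x y -> blue y z -> w != y -> x != z -> w != z -> False.

Variable M : seq (T * T).
Hypothesis mM : matching green M.
Hypothesis max_M : forall M', matching green M' -> size M' <= size M.

Let covered v := v \in support M.
Let uncovered v := v \notin support M.
(** [M] stores one orientation of each edge; forgetting it allows the two ends to be swapped. *)
Let edge x y := ((x, y) \in M) || ((y, x) \in M).

Lemma edgeC x y : edge x y = edge y x.
Proof. exact: orbC. Qed.

Lemma edge_covered x y : edge x y -> covered x /\ covered y.
Proof. by case/orP=> /mem_support[]. Qed.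

Lemma edge_cls x y : edge x y -> cls x != cls y.
Proof.
case/andP: mM => /allP gM _.
by case/orP=> /gM /green_cls //=; rewrite eq_sym.
Qed.

Lemma covered_neq w u : covered w -> uncovered u -> w != u.
Proof. by move=> wM uM; apply: contraNneq uM => <-. Qed.

Lemma uncovered_green u v : uncovered u -> uncovered v -> green u v -> False.
Proof.
move=> uM vM guv; have: matching green ((u, v) :: M).
  case/andP: mM => gM sM; rewrite /matching /= guv gM /= -/(support M) sM.
  rewrite inE negb_or -!/(uncovered _) uM vM !andbT /=.
  by apply: contraNneq (green_cls guv) => ->.
by move/max_M; rewrite /= ltnn.
Qed.

(** Replacing the edge [x y] of [M] by [x u] and [y v] would give a larger green matching. *)
Lemma no_augmenting_path x y u v : edge x y -> uncovered u -> uncovered v ->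
  u != v -> green x u -> green y v -> False.
Proof.
suff aug a b c d : (a, b) \in M -> uncovered c -> uncovered d ->
    c != d -> green a c -> green b d -> False.
  by case/orP=> xyM uM vM uv gxu gyv; [apply: (aug x y u v)|
    apply: (aug y x v u)] => //; rewrite eq_sym.
move=> abM cM dM cd gac gbd; have pM := perm_to_rem abM.
have mM' := mM; rewrite (perm_matching _ pM) in mM'.
have ncd z : uncovered z -> z \notin [:: a, b & support (rem (a, b) M)].
  by rewrite /uncovered (perm_mem (perm_support pM)).
have := ncd c cM; have := ncd d dM; rewrite !inE !negb_or.
case/and3P=> da db dN /and3P[ca cb cN].
have /max_M : matching green [:: (a, c), (b, d) & rem (a, b) M].
  case/andP: mM' => /= /andP[_ gN].
  rewrite -/(support _) inE negb_or => /and3P[/andP[ab aN] bN uN].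
  rewrite /matching /= gac gbd gN /= -/(support _) !inE !negb_or.
  rewrite uN aN bN cN dN ab cd.
  by rewrite eq_sym ca eq_sym da cb eq_sym db.
by rewrite /= size_rem //; case: (M) abM => //= ? ?; rewrite ltnn.
Qed.

Lemma uncovered_red_blue u v : uncovered u -> uncovered v ->
  cls u != cls v -> red u v \/ blue u v.
Proof.
by move=> uM vM /coloured[]; [left|right|move/(uncovered_green uM vM)].
Qed.

Ltac sym := solve [assumption | rewrite eq_sym; assumption
  | rewrite redC; assumption | rewrite blueC; assumption
  | rewrite greenC; assumption | apply: covered_neq; assumption
  | rewrite eq_sym; apply: covered_neq; assumption ].
(* Each of these refutes the goal: by a blue path w x y z, by two red edges at
   x, by a green augmenting path u x y v. *)
Ltac p4 w x y z := exfalso; apply: (@blue_no_P4 w x y z); sym.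
Ltac reds x y z := exfalso;
  apply: (elimN (@eqP _ y z)); [sym | apply: (@red_inj x y z); sym].
Ltac aug x y u v := exfalso; apply: (@no_augmenting_path x y u v); sym.

Lemma cls_neq u v : cls u != cls v -> u != v.
Proof. by apply: contraNneq => ->. Qed.

(** * Uncovered triangles and diamonds *)

(** One of the two pairings of [x], [y] with [u], [v] joins different classes only. Were both of its
    edges green, they would augment [M]. *)
Lemma edge_red_blue x y u v : edge x y -> uncovered u -> uncovered v ->
  cls u != cls v -> exists w z, [/\ w \in [:: x; y], z \in [:: u; v]
    & red w z \/ blue w z].
Proof.
move=> xy uM vM uv; have xM := edge_cls xy; have uv' := cls_neq uv.
have wit w z : w \in [:: x; y] -> z \in [:: u; v] -> red w z \/ blue w z ->
    exists w z, [/\ w \in [:: x; y], z \in [:: u; v] & red w z \/ blue w z].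
  by move=> wxy zuv c; exists w, z.
have core a b : a \in [:: u; v] -> b \in [:: u; v] -> uncovered a ->
    uncovered b -> a != b -> cls x != cls a -> cls y != cls b ->
    exists w z, [/\ w \in [:: x; y], z \in [:: u; v] & red w z \/ blue w z].
  move=> ain bin aM bM ab /coloured[c1|c1|c1] /coloured[c2|c2|c2];
    try (by apply: (wit x a) => //; rewrite ?mem_head; auto);
    try (by apply: (wit y b) => //; rewrite ?inE ?eqxx ?orbT; auto).
  by aug x y a b.
have vu : v != u by rewrite eq_sym.
have [xu|xu] := eqVneq (cls x) (cls u).
  apply: (core v u); rewrite ?mem_head ?inE ?eqxx ?orbT //; first by rewrite xu.
  by rewrite -xu eq_sym.
have [yv|yv] := eqVneq (cls y) (cls v).
  apply: (core v u); rewrite ?mem_head ?inE ?eqxx ?orbT //;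
    first by rewrite -yv.
  by rewrite yv eq_sym.
by apply: (core u v); rewrite ?inE ?eqxx ?orbT.
Qed.

(** The other two sides [u z] and [v z] must be blue. The edge of [M] sends a red or blue edge to
    [u] or [v]: red gives a second red edge there, blue extends the blue path through [z] to a
    P_4. *)
Lemma triangle_red_edge u v z x y : uncovered u -> uncovered v ->
    uncovered z -> cls u != cls v -> cls u != cls z -> cls v != cls z ->
  red u v -> edge x y -> False.
Proof.
move=> uM vM zM uv uz vz ruv xy.
have [xM yM] := edge_covered xy.
have uv' := cls_neq uv; have uz' := cls_neq uz; have vz' := cls_neq vz.
have buz : blue u z.
  by case: (uncovered_red_blue uM zM uz) => // ruz; reds u v z.
have bvz : blue v z.
  by case: (uncovered_red_blue vM zM vz) => // rvz; reds v u z.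
have [w [t [wxy tuv wt]]] := edge_red_blue xy uM vM uv.
have wM : covered w by move: wxy; rewrite !inE => /pred2P[]->.
move: tuv wt; rewrite !inE => /pred2P[]-> []c.
- by reds u v w.
- by p4 w u z v.
- by reds v u w.
- by p4 w v z u.
Qed.

(** By [triangle_red_edge] the triangle is entirely blue, so no covered vertex sends it a blue edge.
    By [edge_red_blue], each edge of [M] then sends red edges to at least two of its three vertices,
    and two edges of [M] would put two red edges at a common vertex. *)
Lemma rainbow_triangle u v z : uncovered u -> uncovered v -> uncovered z ->
  cls u != cls v -> cls u != cls z -> cls v != cls z -> size M <= 1.
Proof.
move=> uM vM zM uv uz vz; rewrite leqNgt -(count_predT M); apply/negP.
case/(matching_two_edges mM) => x [y] [x'] [y'] [xyM xyM' _ _].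
have uv' := cls_neq uv; have uz' := cls_neq uz; have vz' := cls_neq vz.
have xy : edge x y by rewrite /edge xyM.
have xy' : edge x' y' by rewrite /edge xyM'.
have buv : blue u v.
  by case: (uncovered_red_blue uM vM uv) => // /triangle_red_edge /(_ xy) F;
    case: (F z).
have buz : blue u z.
  by case: (uncovered_red_blue uM zM uz) => // /triangle_red_edge /(_ xy) F;
    case: (F v) => //; rewrite eq_sym.
have bvz : blue v z.
  by case: (uncovered_red_blue vM zM vz) => // /triangle_red_edge /(_ xy) F;
    case: (F u) => //; rewrite eq_sym.
rewrite /= !inE !negb_or andbT => /and3P[/and3P[_ xx' xy'_] /andP[yx' yy'] _].
have noblue w t : covered w -> t \in [:: u; v; z] -> blue w t -> False.
  move=> wM; rewrite !inE => /or3P[]/eqP-> c.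
  - by p4 w u v z.
  - by p4 w v u z.
  by p4 w z u v.
pose R a b t := red a t || red b t.
have RP a b s t : edge a b -> s \in [:: u; v; z] -> t \in [:: u; v; z] ->
    cls s != cls t -> R a b s || R a b t.
  have uP q : q \in [:: u; v; z] -> uncovered q.
    by rewrite !inE => /or3P[]/eqP->.
  move=> ab su tu st; have [aM bM] := edge_covered ab.
  have [w [q [wab qst []c]]] := edge_red_blue ab (uP s su) (uP t tu) st.
    move: wab qst c; rewrite /R !inE => /pred2P[]-> /pred2P[]-> ->;
    by rewrite ?orbT.
  case: (noblue w q) => //; first by move: wab; rewrite !inE => /pred2P[]->.
  by move: qst; rewrite !inE => /pred2P[]->; move: su tu; rewrite !inE.
have RR t : R x y t -> R x' y' t -> False.
  move=> /orP[]c1 /orP[]c2.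
  - by reds t x x'.
  - by reds t x y'.
  - by reds t y x'.
  by reds t y y'.
have tT : [/\ u \in [:: u; v; z], v \in [:: u; v; z] & z \in [:: u; v; z]].
  by rewrite !inE !eqxx !orbT.
case: tT => uT vT zT.
have := RP _ _ _ _ xy uT vT uv; have := RP _ _ _ _ xy uT zT uz.
have := RP _ _ _ _ xy vT zT vz.
have := RP _ _ _ _ xy' uT vT uv; have := RP _ _ _ _ xy' uT zT uz.
have := RP _ _ _ _ xy' vT zT vz.
by move=> /orP[]? /orP[]? /orP[]? /orP[]? /orP[]? /orP[]?;
  solve [exact: (RR u) | exact: (RR v) | exact: (RR z)].
Qed.

(** The five pairs other than [u u'] span K_4 minus an edge. Deleting a red matching from it always
    leaves a P_4, which would be blue. *)
Lemma no_uncovered_diamond u u' v w : uncovered u -> uncovered u' ->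
    uncovered v -> uncovered w -> u != u' -> cls u = cls u' ->
  cls u != cls v -> cls u != cls w -> cls v != cls w -> False.
Proof.
move=> uM u'M vM wM uu' clsu uv uw vw.
have u'v := uv; have u'w := uw; rewrite clsu in u'v u'w.
have uv' := cls_neq uv; have uw' := cls_neq uw; have vw' := cls_neq vw.
have u'v' := cls_neq u'v; have u'w' := cls_neq u'w.
case: (uncovered_red_blue vM wM vw) => c1;
case: (uncovered_red_blue uM vM uv) => c2; try reds v u w;
case: (uncovered_red_blue u'M vM u'v) => c3; try reds v u' w;
try reds v u u';
case: (uncovered_red_blue uM wM uw) => c4; try reds w u v;
try reds u v w;
case: (uncovered_red_blue u'M wM u'w) => c5; try reds w u' v;
try reds u' v w; try reds w u u'.
all: try p4 u v u' w.
all: try p4 u v w u'.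
all: try p4 u w v u'.
Qed.

(** * Edges of [M] avoiding a class with several uncovered vertices *)

(** A red [w u] would be a second red edge at [u], and a blue one would complete the blue path
    [u w v z]. *)
Lemma outside_green u v z w : uncovered u -> uncovered v -> uncovered z ->
    covered w -> u != v -> u != z -> v != z -> cls w != cls u ->
  red z u -> blue z v -> blue w v -> green w u.
Proof.
move=> uM vM zM wM uv uz vz wu rzu bzv bwv.
case: (coloured wu) => // c; first by reds u w z.
by p4 u w v z.
Qed.

Lemma outside_blue u z w : uncovered u -> uncovered z -> covered w ->
  cls w != cls u -> red z u -> ~~ green w u -> blue w u.
Proof.
move=> uM zM wM wu rzu; case: (coloured wu) => // c; last by rewrite c.
by move=> _; reds u w z.
Qed.

(* Two edges of M avoiding the class of u and v would give v two red edges. *)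
Lemma cherry_red_edge u v z x y : uncovered u -> uncovered v ->
    uncovered z -> u != v -> u != z -> v != z -> cls u = cls v ->
    red z u -> blue z v -> edge x y -> cls x != cls u -> cls y != cls u ->
  red x v \/ red y v.
Proof.
move=> uM vM zM uv uz vz cuv rzu bzv xy xu yu.
(* The ends of an edge of [M] lie in different classes, so one of them, called [a], is outside the
   class of [z]; this makes [a z] a coloured edge. *)
have [a [b [ab az au bu suff_ab]]] : exists a b, [/\ edge a b,
    cls a != cls z, cls a != cls u, cls b != cls u &
    (red a v \/ red b v -> red x v \/ red y v)].
  have [xz|] := eqVneq (cls x) (cls z); last by exists x, y.
  exists y, x; rewrite edgeC; split=> //; last tauto.
  by rewrite -xz eq_sym edge_cls.
apply: suff_ab; have av := au; have bv := bu; rewrite cuv in av bv.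
have [aM bM] := edge_covered ab; have anb := cls_neq (edge_cls ab).
have zu : z != u by rewrite eq_sym.
case: (coloured av) => cav; first by left.
  have gau := outside_green uM vM zM aM uv uz vz au rzu bzv cav.
  case: (coloured bv) => cbv; first by right.
    have gbu := outside_green uM vM zM bM uv uz vz bu rzu bzv cbv.
    case: (coloured az) => caz; first by reds z a u.
      by p4 a z v b.
    by aug a b z u.
  by aug a b u v.
have bau : blue a u \/ green a u.
  by case: (coloured au); auto => c; reds u a z.
case: (coloured bv) => cbv; first by right.
  have gbu := outside_green uM vM zM bM uv uz vz bu rzu bzv cbv.
  by aug a b v u.
case: (coloured bu) => cbu; [by reds u b z| |by aug a b v u].
case: bau => cau; last by aug a b u v.
case: (coloured az) => caz; first by reds z a u.
  by p4 b u a z.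
by aug a b z v.
Qed.

(** If [z u] and [z v] differ in colour, [cherry_red_edge] gives the end of the blue one two red
    edges. Both cannot be red. If both are blue, blue edges from covered vertices to [u] or [v] are
    excluded, and each edge of [M] is forced to send a red edge to [u] and one to [v]. *)
Lemma two_edges_cherry u v z x y x' y' : uncovered u -> uncovered v ->
    uncovered z -> u != v -> cls u = cls v -> cls u != cls z ->
    edge x y -> edge x' y' -> uniq [:: x; y; x'; y'] ->
    cls x != cls u -> cls y != cls u -> cls x' != cls u -> cls y' != cls u ->
  False.
Proof.
move=> uM vM zM uv cuv uz xy xy' uni xu yu xu' yu'.
have vu : v != u by rewrite eq_sym.
have vz := uz; rewrite cuv in vz.
have uz' := cls_neq uz; have vz' := cls_neq vz.
have [xv yv xv' yv'] : [/\ cls x != cls v, cls y != cls v,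
    cls x' != cls v & cls y' != cls v] by rewrite -cuv.
move: uni; rewrite /= !inE !negb_or andbT.
case/and3P=> /and3P[_ nxx' nxy'] /andP[nyx' nyy'] _.
have RR t : red x t \/ red y t -> red x' t \/ red y' t -> False.
  by case=> c1 [] c2; [reds t x x'|reds t x y'|reds t y x'|reds t y y'].
case: (uncovered_red_blue uM zM uz) => cuz.
  have bzv : blue z v.
    by case: (uncovered_red_blue vM zM vz) => c; [reds z u v|sym].
  by apply: (RR v); apply: (@cherry_red_edge u v z) => //; sym.
case: (uncovered_red_blue vM zM vz) => cvz.
  by apply: (RR u); apply: (@cherry_red_edge v u z) => //; sym.
have noblue w : covered w -> (blue w u -> False) /\ (blue w v -> False).
  by move=> wM; split=> c; [p4 w u z v|p4 w v z u].
(* Each of the two pairings of [a], [b] with [u], [v] contains an edge that is not green, hence red.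
   The disjunction covers the four ways to pick one from each pairing. *)
have red_uv a b : edge a b -> cls a != cls u -> cls b != cls u ->
    cls a != cls v -> cls b != cls v ->
    (red a u \/ red b u) /\ (red a v \/ red b v) \/
    (red a u /\ red b u) \/ (red a v /\ red b v).
  move=> ab au bu av bv; have [aM bM] := edge_covered ab.
  have [nau nav] := noblue a aM; have [nbu nbv] := noblue b bM.
  have cf1 : green a u -> green b v -> False by move=> *; aug a b u v.
  have cf2 : green a v -> green b u -> False by move=> *; aug a b v u.
  case: (coloured au) => ?; case: (coloured bu) => ?;
  case: (coloured av) => ?; case: (coloured bv) => ?; tauto.
have dbl t a b : edge a b -> red a t /\ red b t -> False.
  by move=> ab [ca cb]; have anb := cls_neq (edge_cls ab); reds t a b.
have := red_uv x y xy xu yu xv yv; have := red_uv x' y' xy' xu' yu' xv' yv'.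
have := RR u; have := RR v; have := dbl u x y xy; have := dbl v x y xy.
have := dbl u x' y' xy'; have := dbl v x' y' xy'.
tauto.
Qed.

(** This handles a class with three uncovered vertices, where an uncovered vertex of another class
    need not be at hand. *)
Lemma two_edges_triple u v z x y x' y' : uncovered u -> uncovered v ->
    uncovered z -> uniq [:: u; v; z] -> cls v = cls u -> cls z = cls u ->
    edge x y -> edge x' y' -> uniq [:: x; y; x'; y'] ->
    cls x != cls u -> cls y != cls u -> cls x' != cls u -> cls y' != cls u ->
  False.
Proof.
move=> uM vM zM uniT cv cz xy xy' uni xu yu xu' yu'.
move: uni; rewrite /= !inE !negb_or andbT.
case/and3P=> /and3P[_ nxx' nxy'] /andP[nyx' nyy'] _.
set S := [:: u; v; z].
have SM t : t \in S -> uncovered t by rewrite !inE => /or3P[]/eqP->.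
have Sc t : t \in S -> cls t = cls u by rewrite !inE => /or3P[]/eqP->.
(* B holds at two vertices of S for each edge of M, but B x y t and B x' y' t
   clash: t has a blue edge to both edges of M, so by P_4-freeness neither
   blue neighbour has a second one, and t gets two red edges. *)
pose B a b t := exists w w', [/\ w = a /\ w' = b \/ w = b /\ w' = a,
  blue w t & (exists q, [/\ q != t, uncovered q & blue w q]) \/ red w' t].
have BB t : uncovered t -> B x y t -> B x' y' t -> False.
  move=> tM [w [r [wxy bwt c]]] [w' [r' [wxy' bwt' c']]].
  have [xM yM] := edge_covered xy; have [xM' yM'] := edge_covered xy'.
  have {}wxy : (w == x) && (r == y) || (w == y) && (r == x).
    by case: wxy => -[-> ->]; rewrite !eqxx ?orbT.
  have {}wxy' : (w' == x') && (r' == y') || (w' == y') && (r' == x').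
    by case: wxy' => -[-> ->]; rewrite !eqxx ?orbT.
  have [wM wM' nww' nrr'] : [/\ covered w, covered w', w != w' & r != r'].
    by case/orP: wxy => /andP[/eqP-> /eqP->];
       case/orP: wxy' => /andP[/eqP-> /eqP->].
  case: c => [[q [qt qM bwq]]|c]; first by p4 q w t w'.
  case: c' => [[q [qt qM bwq]]|c']; first by p4 q w' t w.
  by reds t r r'.
have blue2 a b w s t : s \in S -> t \in S -> s != t -> w \in [:: a; b] ->
    blue w s -> blue w t -> B a b s /\ B a b t.
  move=> sS tS st wab bs bt.
  have [w' ww'] : exists w', w = a /\ w' = b \/ w = b /\ w' = a.
    by move: wab; rewrite !inE => /pred2P[]->; [exists b|exists a]; auto.
  split; exists w, w'; split=> //; left; [exists t|exists s]; split=> //;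
    by [rewrite eq_sym|exact: SM].
have two_B a b : edge a b -> cls a != cls u -> cls b != cls u ->
    exists s t, [/\ s \in S, t \in S, s != t, B a b s & B a b t].
  move=> ab au bu; have [aM bM] := edge_covered ab.
  have anb := cls_neq (edge_cls ab).
  have col w t : w \in [:: a; b] -> t \in S -> ~~ green w t ->
      red w t \/ blue w t.
    move=> wab tS /negP ng; have : cls w != cls t.
      by rewrite (Sc t tS); move: wab; rewrite !inE => /pred2P[]->.
    by case/coloured; auto.
  (* Without green edges to [S], at most one of the three edges from [w] is red, so two are blue. *)
  have full w : w \in [:: a; b] -> ~~ has (green w) S ->
      exists s t, [/\ s \in S, t \in S, s != t, B a b s & B a b t].
    move=> wab /hasPn ngw.
    have colw t tS := col w t wab tS (ngw t tS).
    have [s [t [sS tS st bs bt]]] : exists s t,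
        [/\ s \in S, t \in S, s != t, blue w s & blue w t].
      move: uniT; rewrite /= !inE negb_or andbT => /andP[/andP[uv uz] vz].
      have [uS vS zS] : [/\ u \in S, v \in S & z \in S].
        by rewrite !inE !eqxx !orbT.
      case: (colw u uS) => c1.
        exists v, z; split=> //.
          by case: (colw v vS) => // c; reds w u v.
        by case: (colw z zS) => // c; reds w u z.
      case: (colw v vS) => c2; last by exists u, v.
      exists u, z; split=> //.
      by case: (colw z zS) => // c; reds w v z.
    by have [Bs Bt] := blue2 a b w s t sS tS st wab bs bt; exists s, t.
  have aab : a \in [:: a; b] by rewrite mem_head.
  have bab : b \in [:: a; b] by rewrite !inE eqxx orbT.
  case: (boolP (has (green a) S)) => [/hasP[p pS gap]|]; last exact: full.
  case: (boolP (has (green b) S)) => [/hasP[q qS gbq]|]; last exact: full.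
  have pM := SM p pS; have qM := SM q qS.
  (* Green neighbours of [a] and [b] in [S] coincide, since distinct ones would augment [M]. So the
     other two vertices of [S] have only red and blue edges to [a] and [b]. *)
  have pq : p = q by have [//|npq] := eqVneq p q; aug a b p q.
  have [s [t [sS tS st sp tp]]] : exists s t,
      [/\ s \in S, t \in S, s != t, s != p & t != p].
    move: uniT; rewrite /= !inE negb_or andbT.
    case/andP=> /andP[uv uz] vz; rewrite eq_sym in uv; move: (uv) (uz) (vz).
    rewrite [u == z]eq_sym [v == z]eq_sym => vu zu zv.
    move: pS; rewrite !inE => /or3P[]/eqP->;
      [exists v, z|exists u, z|exists u, v];
      by rewrite !inE !eqxx !orbT; split=> //; sym.
  have sM := SM s sS; have tM := SM t tS.
  have ng r : r \in S -> r != p -> ~~ green a r /\ ~~ green b r.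
    move=> rS rp; have rM := SM r rS; subst q; split; apply/negP => c.
      by aug a b r p.
    by aug a b p r.
  have [nas nbs] := ng s sS sp; have [nat_ nbt] := ng t tS tp.
  (* Either [a] or [b] is blue to both [s] and [t], or the four edges alternate in colour and each
     of [s], [t] gets one red and one blue edge. *)
  exists s, t; split=> //; case: (col a s aab sS nas) => cas;
  case: (col b s bab sS nbs) => cbs; case: (col a t aab tS nat_) => cat;
  case: (col b t bab tS nbt) => cbt;
  try (by reds a s t); try (by reds b s t); try (by reds s a b);
  try (by reds t a b);
  try (by have [] := blue2 a b a s t sS tS st aab cas cat);
  try (by have [] := blue2 a b b s t sS tS st bab cbs cbt);
  solve [by exists a, b; split; auto | by exists b, a; split; auto].
have [s [t [sS tS st Bs Bt]]] := two_B x y xy xu yu.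
have [s' [t' [sS' tS' st' Bs' Bt']]] := two_B x' y' xy' xu' yu'.
(* Two pairs inside the three-element [S] share a vertex. *)
have [r [rS Br Br']] : exists r, [/\ r \in S, B x y r & B x' y' r].
  have [ss'|nss'] := eqVneq s s'; first by exists s; rewrite ss' in sS Bs *.
  have [st''|nst'] := eqVneq s t'; first by exists s; rewrite st'' in sS Bs *.
  exists t; have [ts'|nts'] := eqVneq t s'; first by rewrite ts' in tS Bt *.
  have [tt'|ntt'] := eqVneq t t'; first by rewrite tt' in tS Bt *.
  have : size [:: s; t; s'; t'] <= size S.
    apply: uniq_leq_size; last first.
      by apply/(@allP _ (mem S)); apply/and5P.
    by rewrite /= !inE !negb_or st nss' nst' nts' ntt' st'.
  by [].
by apply: (BB r) => //; apply: SM.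
Qed.

(** * Counting covered vertices class by class *)

Let meets i := count (fun v => cls v == i) (support M).
Let avoids i (e : T * T) := (cls e.1 != i) && (cls e.2 != i).

(** An edge of [M] has at most one end in class [i], and it avoids the class when it has none. *)
Lemma meets_bounds i :
  meets i <= size M /\ size M <= meets i + count (avoids i) M.
Proof.
have : all (fun e => cls e.1 != cls e.2) M.
  by apply/allP=> -[x y] xyM; apply: edge_cls; rewrite /edge xyM.
rewrite /meets /avoids; elim: (M) => //= e N IH /andP[ne /IH {IH}].
rewrite -/(support N); move: ne.
by have [->|_] := eqVneq (cls e.1) i;
  have [_|_] := eqVneq (cls e.2) i => //=; lia.
Qed.

Lemma count_classes (S : seq T) i j k : i != j -> i != k -> j != k ->
  count (fun v => cls v == i) S + count (fun v => cls v == j) S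
    + count (fun v => cls v == k) S = size S.
Proof.
move=> ij ik jk.
have E (c : 'I_3) : (c == i) + (c == j) + (c == k) = 1.
  move: ij ik jk; case: i j k c => [[|[|[|//]]] ?] [[|[|[|//]]] ?];
    by case=> [[|[|[|//]]] ?] [[|[|[|//]]] ?].
by elim: S => //= v S IH; have := E (cls v); lia.
Qed.

Lemma other_classes (i : 'I_3) :
  exists j k, [/\ i != j, i != k & j != k].
Proof.
case: i => [[|[|[|//]]]] lt_i3.
- by exists (inord 1), (inord 2); rewrite -!(inj_eq val_inj) /= !inordK.
- by exists (inord 0), (inord 2); rewrite -!(inj_eq val_inj) /= !inordK.
- by exists (inord 0), (inord 1); rewrite -!(inj_eq val_inj) /= !inordK.
Qed.

Lemma large_max_matching t : 1 < t ->
  (forall i, #|[pred v | cls v == i]| = t) -> 3 * t <= 2 * size M + 2.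
Proof.
move=> t_gt1 card_cls; rewrite leqNgt; apply/negP=> small_M.
have uM : uniq (support M) by case/andP: mM.
pose free i := [pred v | (cls v == i) && uncovered v].
have freeE i : #|free i| + meets i = t.
  by rewrite -(card_cls i); apply: card_uncovered uM.
have freeP i : 0 < #|free i| -> exists2 u, uncovered u & cls u = i.
  by case/card_gt0P=> u; rewrite inE => /andP[/eqP ui uuM]; exists u.
have free2P i : 1 < #|free i| ->
    exists u v, [/\ uncovered u, uncovered v, u != v, cls u = i & cls v = i].
  case/card_gt1P=> u [v [ui vi uv]]; exists u, v; move: ui vi.
  by rewrite !inE => /andP[/eqP ? ?] /andP[/eqP ? ?].
have sum_meets i j k : i != j -> i != k -> j != k ->
    meets i + meets j + meets k = 2 * size M.
  by move=> ij ik jk; rewrite /meets count_classes // size_support mul2n.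
have avoid1 i : 1 < #|free i| -> count (avoids i) M <= 1.
  move=> free2; rewrite leqNgt; apply/negP.
  case/(matching_two_edges mM) => x [y] [x'] [y'].
  rewrite /avoids /= => -[xyM xyM' /andP[xi yi] /andP[xi' yi'] uni].
  have xy : edge x y by rewrite /edge xyM.
  have xy' : edge x' y' by rewrite /edge xyM'.
  have [free3|free_le2] := ltnP 2 #|free i|.
    case/card_gt2P: free3 => u [v [z [[ui vi zi] [uv vz zu]]]].
    move: ui vi zi; rewrite !inE.
    move=> /andP[/eqP ui uuM] /andP[/eqP vi vM] /andP[/eqP zi zM].
    apply: (@two_edges_triple u v z x y x' y') => //; rewrite ?ui //.
    by rewrite /= !inE negb_or uv vz eq_sym zu.
  have [u [v [uuM vM uv ui vi]]] := free2P i free2.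
  have [j [k [ij ik jk]]] := other_classes i.
  (* At least three vertices are uncovered and only two of them lie in class [i]. *)
  have [z zM zi] : exists2 z, uncovered z & cls z != i.
    have [fj|/freeP[z zM zc]] := posnP #|free j|; last first.
      by exists z; rewrite // zc eq_sym.
    have [fk|/freeP[z zM zc]] := posnP #|free k|; last first.
      by exists z; rewrite // zc eq_sym.
    have := sum_meets i j k ij ik jk.
    have := freeE i; have := freeE j; have := freeE k.
    by clear - small_M free_le2 fj fk; lia.
  by apply: (@two_edges_cherry u v z x y x' y') => //;
    rewrite ui ?vi // eq_sym.
(* Class [i] has at most [t - 2] covered vertices and at most one edge of [M] avoids it, so
   [size M <= t - 1]; this bounds the covered vertices of class [j]. *)
have free_all i : 1 < #|free i| -> forall j, 0 < #|free j|.
  move=> free2 j; have := avoid1 i free2.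
  have := meets_bounds i; have := meets_bounds j.
  have := freeE i; have := freeE j; lia.
(* If neither other class has two uncovered vertices, they hold at most two of the at least three,
   leaving one for class [j]. *)
have free_gt0 j : 0 < #|free j|.
  have [p [q [jp jq pq]]] := other_classes j.
  have [/free_all//|fp] := ltnP 1 #|free p|.
  have [/free_all//|fq] := ltnP 1 #|free q|.
  have := sum_meets _ _ _ jp jq pq.
  have := freeE j; have := freeE p; have := freeE q; lia.
have [p [q [pq pr qr]]] := other_classes ord0.
have sM := sum_meets _ _ _ pq pr qr.
have [u0 u0M u0c] := freeP _ (free_gt0 ord0).
have [up upM upc] := freeP _ (free_gt0 p).
have [uq uqM uqc] := freeP _ (free_gt0 q).
have M_le1 : size M <= 1.
  by apply: (@rainbow_triangle u0 up uq); rewrite ?u0c ?upc ?uqc.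
(* Since [t >= 2] and [size M <= 1], at least [3 * t - 2 >= 4] vertices are uncovered, so two share
   a class. *)
have [i free2] : exists i, 1 < #|free i|.
  have := freeE ord0; have := freeE p; have := freeE q => f1 f2 f3.
  have [|] := ltnP 1 #|free ord0|; first by exists ord0.
  have [|] := ltnP 1 #|free p|; first by exists p.
  have [|] := ltnP 1 #|free q|; first by exists q.
  lia.
have [j [k [ij ik jk]]] := other_classes i.
have [u [v [uuM vM uv ui vi]]] := free2P i free2.
have [w wM wc] := freeP _ (free_gt0 j).
have [z zM zc] := freeP _ (free_gt0 k).
by apply: (@no_uncovered_diamond u v w z) => //; rewrite ?ui ?vi ?wc ?zc.
Qed.

End ColouredMultipartite.

(** * From relations to monochromatic copies *)

Lemma contains_cherry (G : sgraph) (x y z : G) :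
  adj x y -> adj x z -> y != z -> contains_copy G (complete_bipartite 1 2).
Proof.
move=> xy xz yz.
have neq (u v : G) : adj u v -> u != v.
  by apply: contraTneq => ->; rewrite adj_irrefl.
have [nxy nxz] := (neq _ _ xy, neq _ _ xz).
exists (fun v => match v with inl _ => x
          | inr i => if val i == 0 then y else z end).
split.
  move=> [i|[[|[|//]] ?]] [j|[[|[|//]] ?]] //=; try by move/eqP; rewrite
    ?(negPf nxy) ?(negPf nxz) ?(negPf yz) // eq_sym
    ?(negPf nxy) ?(negPf nxz) ?(negPf yz).
  - by rewrite [i]ord1 [j]ord1.
  - by move=> _; congr inr; apply: val_inj.
  - by move=> _; congr inr; apply: val_inj.
by move=> [i|[[|[|//]] ?]] [j|[[|[|//]] ?]] //=; rewrite adj_sym.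
Qed.

Lemma contains_path4 (G : sgraph) (w x y z : G) :
  adj w x -> adj x y -> adj y z -> w != y -> x != z -> w != z ->
  contains_copy G (path_graph 4).
Proof.
move=> wx xy yz wy xz wz.
have neq (u v : G) : adj u v -> u != v.
  by apply: contraTneq => ->; rewrite adj_irrefl.
exists (fun i : 'I_4 => nth w [:: w; x; y; z] i); split.
  move=> i j /eqP; rewrite nth_uniq //; first by move/eqP/val_inj.
  by rewrite /= !inE !negb_or (neq w x) ?(neq x y) ?(neq y z) ?wy ?xz ?wz.
by move=> [[|[|[|[|//]]]] ?] [[|[|[|[|//]]]] ?] //= _; rewrite // adj_sym.
Qed.

Lemma contains_matching (G : sgraph) (n : nat) (M : seq (G * G)) :
  matching (@adj G) M -> n <= size M -> contains_copy G (matching_graph n).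
Proof.
move=> /andP[/allP adjM uM] le_nM.
pose e (v : 'I_n * bool) := tnth (in_tuple M) (widen_ord le_nM v.1).
pose f (v : 'I_n * bool) := (if v.2 then snd else fst) (e v).
(* The ends of the [i]-th edge sit at positions [2 * i] and [2 * i + 1] of the support. Injectivity
   of [f] follows from [uniq], with half and parity recovering the index and the end. *)
have fE x0 v : f v = nth x0 (support M) (v.1.*2 + v.2).
  rewrite nth_support; last exact: leq_trans (ltn_ord _) le_nM.
  by rewrite /f /e (tnth_nth (x0, x0)).
exists f; split=> [[i a] [j b]|[i a] [j b]] /=.
  have ltM (k : 'I_n) (c : bool) : k.*2 + c < (size M).*2.
    apply: (@leq_trans k.+1.*2).
      by rewrite doubleS -addn2 -addnS leq_add2l; case: c.
    by rewrite leq_double; apply: leq_trans (ltn_ord k) le_nM.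
  (* [nth] needs a default value; any vertex in the image serves. *)
  have x0 : G := f (i, a).
  move/eqP; rewrite !(fE x0) nth_uniq ?size_support //= => /eqP E.
  congr pair.
    apply/val_inj; move/(congr1 half): E.
    by rewrite ![_.*2 + _]addnC !half_bit_double.
  by move/(congr1 odd): E; rewrite !oddD !odd_double !oddb.
case/andP=> /= /eqP<-; rewrite /f /e /=.
have := adjM _ (mem_tnth (widen_ord le_nM i) (in_tuple M)).
by case: a; case: b => //=; rewrite adj_sym.
Qed.

Lemma arrows_cherry_path4_matching (n t : nat) : 1 < t -> 2 * n < 3 * t ->
  arrows (complete_multipartite 3 t)
    (complete_bipartite 1 2) (path_graph 4) (matching_graph n).
Proof.
move=> t_gt1 lt_n3t c.
have [?|no_cherry] := classic (contains_copy
    (colour_class c (inord 0)) (complete_bipartite 1 2)).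
  by exists (inord 0); rewrite /family3 /= inordK.
have [?|no_P4] := classic (contains_copy
    (colour_class c (inord 1)) (path_graph 4)).
  by exists (inord 1); rewrite /family3 /= inordK.
exists (inord 2); rewrite /family3 /= inordK //.
have [M mM max_M] := ex_max_matching (colour_adj c (inord 2)).
suff leM : 3 * t <= 2 * size M + 2.
  (* From [2 * n < 3 * t <= 2 * size M + 2] follows [n < size M + 1]. *)
  have le_nM : n <= size M by lia.
  exact: (contains_matching (G := colour_class c (inord 2)) mM le_nM).
apply: (@large_max_matching _ fst (colour_adj c (inord 0))
  (colour_adj c (inord 1)) (colour_adj c (inord 2))) => //;
  try exact: (colour_sym (K := complete_multipartite 3 t)).
- move=> u v uv; rewrite /colour_adj /= /multipartite_adj uv /=.
  move: (c _) => i; rewrite -!(inj_eq val_inj) /= !inordK //.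
  by case: i => [[|[|[|//]]] ?]; [apply: Or31|apply: Or32|apply: Or33].
- by move=> u v /andP[].
- move=> x y z xy xz; apply/eqP/negPn/negP => yz; apply: no_cherry.
  exact: (@contains_cherry (colour_class c (inord 0)) x y z).
- move=> w x y z wx xy yz wy xz wz; apply: no_P4.
  exact: (@contains_path4 (colour_class c (inord 1)) w x y z).
move=> i; suff : #|[pred v : 'I_3 * 'I_t | v.1 == i]| = t by [].
have := cardX (pred1 i) (@predT 'I_t); rewrite card1 card_ord mul1n.
by apply: etrans; apply: eq_card => v; rewrite !inE andbT.
Qed.

(** Being an arrowing number is a plain proposition, so the minimum comes from strong induction and
    excluded middle. *)
Lemma least_nat (P : nat -> Prop) m : P m ->
  exists k, [/\ P k, k <= m & forall s, P s -> k <= s].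
Proof.
elim/ltn_ind: m => m IH Pm.
have [[s [lt_sm Ps]]|min_m] := classic (exists s, s < m /\ P s).
  have [k [Pk le_ks min_k]] := IH s lt_sm Ps.
  by exists k; split=> //; apply: leq_trans le_ks (ltnW lt_sm).
exists m; split=> // s Ps; rewrite leqNgt.
by apply/negP=> lt_sm; apply: min_m; exists s.
Qed.

Theorem theorem4 (n : nat) (hn : 2 <= n) :
  exists m : nat,
    is_multipartite_ramsey 3
      (complete_bipartite 1 2) (path_graph 4) (matching_graph n) m
    /\ m <= (2 * n) %/ 3 + 1.
Proof.
set t := _ + 1; pose P s := 0 < s /\ arrows (complete_multipartite 3 s)
  (complete_bipartite 1 2) (path_graph 4) (matching_graph n).
have /least_nat[m [[m_gt0 arr_m] le_mt min_m]] : P t.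
  (* The floor plus one strictly exceeds [2 * n / 3], which gives [2 * n < 3 * t]; [n >= 2] makes
     the floor positive, so [1 < t]. *)
  by split; [|apply: arrows_cherry_path4_matching]; rewrite /t; lia.
by exists m; split=> //; split=> // s s_gt0 arr_s; apply: min_m.
Qed.
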